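(* Let $L$ be a link, let $N\in\mathbb{Z}\setminus\{0\}$, and let its $N$-th HOMFLY polynomial be $H^N_L(t)=\sum_{n=-d}^{d} b^N_n\,t^{n/2}$ for some integer $d\ge 0$ (so $b^N_n=0$ for $|n|>d$). Then: (1) for every integer $n$ with $-d\le n\le d$, $$b^N_n=\sum_{i=0}^{2d} f_{d,n}^{(i)}(0)\,v^N_i(L),\qquad f_{d,n}(v)=\prod_{\substack{j=-d\\ j\neq n}}^{d}\frac{2v-j}{n-j};$$ (2) for every integer $n$, the following series converges and $$b^N_n=\sum_{i=0}^{\infty} f_{\infty,n}^{(i)}(0)\,v^N_i(L),\qquad f_{\infty,n}(v)=\begin{cases}\dfrac{\sin\pi(2v-n)}{\pi(2v-n)} & 2v\ne n,\\[2mm] 1 & 2v=n.\end{cases}$$ Here $f^{(i)}$ denotes the $i$-th derivative with respect to $v$.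
   Context: Links are oriented links in $S^3$. The HOMFLY polynomial $H_L(a,z)\in\mathbb{Z}[a^{\pm1},z^{\pm1}]$ is normalized by $H_{\mathrm{unknot}}=1$ and $aH_{L_+}-a^{-1}H_{L_-}=zH_{L_0}$. For $N\in\mathbb{Z}\setminus\{0\}$, the $N$-th HOMFLY polynomial $H^N_L(t)\in\mathbb{Z}[t^{\pm 1/2}]$ is obtained by substituting $a=t^{N/2}$, $z=t^{1/2}-t^{-1/2}$ (the Jones polynomial is the case $N=-2$). Setting $t=e^x$ (with $t^{1/2}=e^{x/2}$), the invariants $v^N_i$ are defined by $H^N_L(e^x)=\sum_{i=0}^\infty v^N_i(L)x^i$, i.e. $v^N_i(L)=\frac{1}{i!}\sum_k (k/2)^i b^N_k$ (with $0^0=1$); $v_i^N$ is known to be a Vassiliev invariant of order $i$. *)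

(* Defs.v *)
From HB Require Import structures.
From mathcomp Require Import all_boot all_order all_algebra finmap.
From mathcomp Require Import ring lra.
From mathcomp Require Import all_classical all_reals all_analysis.

Set Implicit Arguments.
Unset Strict Implicit.
Unset Printing Implicit Defensive.

Import Order.TTheory GRing.Theory Num.Theory.
Import numFieldNormedType.Exports.

Local Open Scope ring_scope.
Local Open Scope classical_set_scope.

(** * Oriented links in the 3-sphere *)

Definition sphere3 (R : realType) : set 'rV[R]_4 :=
  [set p | \sum_(j < 4) p 0 j ^+ 2 = 1].

Definition smooth (R : realType) (V : normedModType R) (c : R -> V) : Prop :=
  forall (n : nat) (s : R), derivable c^`(n) s 1.

(* A link is a nonempty finite family of disjoint smoothly embedded circles;
   the circle is R / Z, and each component is oriented by its parameter.
   There are [ncomp.+1] components. *)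
Record link (R : realType) := Link {
  ncomp : nat ;
  curve : 'I_ncomp.+1 -> R -> 'rV[R]_4 ;
  curve_sphere3 : forall i s, sphere3 (curve i s) ;
  curve_smooth : forall i, smooth (curve i) ;
  curve_regular : forall i s, (curve i)^`() s != 0 ;
  curve_periodic : forall i s, curve i (s + 1) = curve i s ;
  curve_inj : forall i j (s t : R), 0 <= s < 1 -> 0 <= t < 1 ->
    curve i s = curve j t -> i = j /\ s = t
}.
Arguments curve {R} l i s.

(* Since the sphere is compact and Hausdorff, each [Phi (t, _)] is a
   homeomorphism of it. *)
Definition ambient_isotopy (R : realType) (Phi : R * 'rV[R]_4 -> 'rV[R]_4) :=
  [/\ {within `[0, 1]%classic `*` @sphere3 R, continuous Phi},
      forall t : R, 0 <= t <= 1 ->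
        set_bij (@sphere3 R) (@sphere3 R) (fun p => Phi (t, p))
    & forall p, sphere3 p -> Phi (0, p) = p].

(* [sigma] matches the components; [rho i] lifts an orientation preserving
   homeomorphism of the circle, so the parametrizations do not matter. *)
Definition isotopic (R : realType) (L L' : link R) : Prop :=
  exists2 Phi, ambient_isotopy Phi &
  exists (sigma : 'I_(ncomp L).+1 -> 'I_(ncomp L').+1)
         (rho : 'I_(ncomp L).+1 -> R -> R),
    bijective sigma /\
    forall i, [/\ continuous (rho i),
                  {homo rho i : s t / s < t},
                  forall s, rho i (s + 1) = rho i s + 1
                & forall s, Phi (1, curve L i s)
                            = curve L' (sigma i) (rho i s)].

Definition circle (R : realType) (s : R) : 'rV[R]_4 :=
  cos (2 * pi * s) *: delta_mx 0 0 + sin (2 * pi * s) *: delta_mx 0 1.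

Lemma is_derive_circle (R : realType) (w s : R) (u v : 'rV[R]_4) :
  is_derive s 1 (fun s : R => cos (w * s) *: u + sin (w * s) *: v)
    (cos (w * s) *: (w *: v) + sin (w * s) *: (- w *: u)).
Proof.
have D i j : is_derive s 1
    (fun s : R => (cos (w * s) *: u + sin (w * s) *: v) i j)
    ((cos (w * s) *: (w *: v) + sin (w * s) *: (- w *: u)) i j).
  rewrite [X in is_derive _ _ X _](_ : _ =
    (fun s : R => cos (w * s) * u i j + sin (w * s) * v i j)); last first.
    by apply/funext => t; rewrite !mxE.
  by apply: is_derive_eq; rewrite !mxE /GRing.scale /=; ring.
have dv : derivable (fun s : R => cos (w * s) *: u + sin (w * s) *: v) s 1.
  by apply/derivable_mxP => i j; case: (D i j).
apply: DeriveDef => //; rewrite derive_mx //; apply/matrixP => i j.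
by rewrite mxE; case: (D i j).
Qed.

Lemma circle_sphere3 (R : realType) (s : R) : sphere3 (circle s).
Proof.
rewrite /sphere3 /= !big_ord_recl big_ord0 /circle !mxE /=.
by rewrite !mulr0 !mulr1 !addr0 !add0r expr0n /= !addr0 cos2Dsin2.
Qed.

Lemma circle_smooth (R : realType) : smooth (@circle R).
Proof.
move=> n; rewrite /circle.
have [u [v ->]] : exists u v : 'rV[R]_4, derive1n n (@circle R) =
    fun s => cos (2 * pi * s) *: u + sin (2 * pi * s) *: v.
  elim: n => [|n [u [v IH]]]; first by do 2 eexists.
  exists ((2 * pi) *: v), (- (2 * pi) *: u); rewrite derive1nS IH.
  apply/funext => s; rewrite derive1E.
  by case: (is_derive_circle (2 * pi) s u v).
by move=> s; case: (is_derive_circle (2 * pi) s u v).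
Qed.

Lemma circle_regular (R : realType) (s : R) : derive1 (@circle R) s != 0.
Proof.
rewrite derive1E /circle.
have [_ ->] := is_derive_circle (2 * pi) s (delta_mx 0 0) (delta_mx 0 1).
apply/eqP => /rowP H; move: (H 0) (H 1); rewrite !mxE /= => H0 H1.
have pi0 : (2 * pi : R) != 0 by rewrite mulf_neq0 ?lt0r_neq0 ?pi_gt0.
have sin0 : sin (2 * pi * s) = 0.
  by apply/(mulIf pi0); rewrite mul0r -[RHS]oppr0 -H0; ring.
have cos0 : cos (2 * pi * s) = 0.
  by apply/(mulIf pi0); rewrite mul0r -H1; ring.
have := cos2Dsin2 (2 * pi * s); rewrite sin0 cos0 expr0n /= addr0.
by move/esym/eqP; rewrite oner_eq0.
Qed.

Lemma circle_periodic (R : realType) (s : R) : circle (s + 1) = circle s.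
Proof.
rewrite /circle mulrDr mulr1 (_ : 2 * pi = pi *+ 2) ?mulr_natl //.
by rewrite cosD2pi sinD2pi.
Qed.

Lemma circle_inj (R : realType) (s t : R) :
  0 <= s < 1 -> 0 <= t < 1 -> circle s = circle t -> s = t.
Proof.
wlog le_ts : s t / t <= s.
  move=> W hs ht; have [/W|/ltW/W W' e] := leP t s; first exact.
  by apply/esym/W'.
move=> /andP[s0 s1] /andP[t0 t1] /rowP H.
move: (H 0) (H 1); rewrite /circle !mxE /= !mulr0 !mulr1 !addr0 !add0r.
move=> Hc Hs.
have p0 := pi_gt0 R.
have cos1 : cos (2 * pi * (s - t)) = 1.
  by rewrite mulrBr cosB Hc Hs -!expr2 cos2Dsin2.
have [le_pi|gt_pi] := leP (2 * pi * (s - t)) pi.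
  have : 2 * pi * (s - t) = 0.
    apply: cos_inj; rewrite ?cos0 // in_itv /= ?lexx ?(ltW p0) ?le_pi ?andbT //.
    by rewrite !mulr_ge0 ?subr_ge0 // ltW.
  move/eqP; rewrite !mulf_eq0 pnatr_eq0 (gt_eqF p0) /= subr_eq0.
  by move/eqP.
have : 2 * pi * (1 - (s - t)) = 0.
  apply: cos_inj; rewrite ?in_itv /=.
  - apply/andP; split; first by rewrite !mulr_ge0 ?ltW //; lra.
    by nra.
  - by rewrite lexx ltW.
  - by rewrite mulrBr mulr1 cosB cos1 mulr_natl cos2pi sin2pi cos0; ring.
move/eqP; rewrite !mulf_eq0 pnatr_eq0 (gt_eqF p0) /= => /eqP; lra.
Qed.

Lemma circle_comp_inj (R : realType) (i j : 'I_1) (s t : R) :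
  0 <= s < 1 -> 0 <= t < 1 -> circle s = circle t -> i = j /\ s = t.
Proof. by move=> hs ht /circle_inj -> //; rewrite !ord1. Qed.

Definition unknot (R : realType) : link R :=
  @Link R 0 (fun=> @circle R) (fun=> @circle_sphere3 R)
    (fun=> @circle_smooth R) (fun=> @circle_regular R)
    (fun=> @circle_periodic R) (@circle_comp_inj R).

(** * Skein triples *)

(* Inverse stereographic projection R^3 -> S^3 from (0, 0, 0, 1).  It preserves
   orientation when S^3 is oriented as the boundary of the 4-ball, so the sign
   of a crossing may be read off in the coordinates x, y, z, with the diagram
   in the (x, y)-plane and the z-axis pointing towards the viewer. *)
Definition chart (R : realType) (x y z : R) : 'rV[R]_4 :=
  let r := x ^+ 2 + y ^+ 2 + z ^+ 2 in
  (r + 1)^-1 *: \row_(j < 4) [:: 2 * x; 2 * y; 2 * z; r - 1]`_j.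

Definition skein_ball (R : realType) : set 'rV[R]_4 :=
  [set p | exists x y z : R, [/\ `|x| <= 2, `|y| <= 1, `|z| <= 1
                           & p = chart x y z]].

(* The positive tangent vectors of a curve; unlike the parametrization, they
   depend only on the curve as an oriented subset. *)
Definition tangents (R : realType) (c : R -> 'rV[R]_4) (D : set R) :
    set ('rV[R]_4 * 'rV[R]_4) :=
  [set pv | exists s l : R, [/\ D s, 0 < l
                               & pv = (c s, l *: (c^`())%classic s)]].

Definition link_tangents (R : realType) (L : link R) :
    set ('rV[R]_4 * 'rV[R]_4) :=
  \bigcup_i tangents (curve L i) setT.

(* An ascending strand (x(s), s, z(s)), -1 <= s <= 1, across the ball. *)
Definition strand (R : realType) (x z : R -> R) : set ('rV[R]_4 * 'rV[R]_4) :=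
  tangents (fun s => chart (x s) s (z s)) `[-1, 1].

Definition in_ball (R : realType) (L : link R) :=
  link_tangents L `&` (@skein_ball R `*` setT).

Definition off_ball (R : realType) (L : link R) :=
  link_tangents L `\` (@skein_ball R `*` setT).

(* Lp, Lm, L0 agree outside the ball; inside, both strands go up, Lp having
   the strand from lower left to upper right on top (a positive crossing), Lm
   having it at the bottom, and L0 being the oriented smoothing )(. The
   functions h and g are the height of the crossing and the half-distance of
   the smoothed strands. *)
Definition skein_triple (R : realType) (Lp Lm L0 : link R) : Prop :=
  [/\ off_ball Lp = off_ball Lm, off_ball Lp = off_ball L0 &
  exists h g : R -> R,
    [/\ smooth h /\ smooth g,
        [/\ h (-1) = 0, h 1 = 0, g (-1) = 1 & g 1 = 1],
        forall s : R, -1 < s < 1 -> 0 < h s < 1 /\ 0 < g s < 1 &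
    [/\ in_ball Lp = strand id h `|` strand -%R (- h),
        in_ball Lm = strand id (- h) `|` strand -%R h &
        in_ball L0 = strand (- g) (cst 0) `|` strand g (cst 0)]]].

(** * Laurent polynomials, given by their finitely many nonzero coefficients *)

(* Z[a^+-1, z^+-1]; [P (i, j)] is the coefficient of a^i z^j. *)
Definition laurent2 := {fsfun int * int -> int with 0}.

(* Z[q^+-1], used with q = t^(1/2); [P n] is the coefficient of t^(n/2). *)
Definition laurent1 := {fsfun int -> int with 0}.

Definition eval2 (F : fieldType) (P : laurent2) (a z : F) : F :=
  \sum_(k <- finsupp P) (P k)%:~R * a ^ k.1 * z ^ k.2.

Definition eval1 (F : fieldType) (P : laurent1) (q : F) : F :=
  \sum_(n <- finsupp P) (P n)%:~R * q ^ n.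

(** * The HOMFLY polynomial *)

Definition frac_az := {fraction {poly {poly int}}}.
Definition var_a : frac_az := tofrac ('X%:P : {poly {poly int}}).
Definition var_z : frac_az := tofrac ('X : {poly {poly int}}).

(* Laurent polynomials are compared in the field of fractions Q(a, z), into
   which this embeds them. *)
Definition in_az (P : laurent2) : frac_az := eval2 P var_a var_z.

(* H is the HOMFLY polynomial: the link invariant determined by its value on
   the unknot and the skein relation. *)
Definition is_homfly (R : realType) (H : link R -> laurent2) : Prop :=
  [/\ forall L L', isotopic L L' -> H L = H L',
      in_az (H (unknot R)) = 1
    & forall Lp Lm L0, skein_triple Lp Lm L0 ->
        var_a * in_az (H Lp) - var_a^-1 * in_az (H Lm)
        = var_z * in_az (H L0)].

Definition frac_q := {fraction {poly int}}.
Definition var_q : frac_q := tofrac ('X : {poly int}).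

(* HN in Z[t^+-1/2] is the result of substituting a = t^(N/2) and
   z = t^(1/2) - t^(-1/2) in P; the substitution takes place in Q(t^(1/2)),
   as P may contain negative powers of z. *)
Definition Nth_specialization (N : int) (P : laurent2) (HN : laurent1) : Prop :=
  eval2 P (var_q ^ N) (var_q - var_q^-1) = eval1 HN var_q.

(** * The coefficients v_i and the functions f *)

Definition vcoef (R : realType) (HN : laurent1) (i : nat) : R :=
  i`!%:R^-1 * \sum_(k <- finsupp HN) (k%:~R / 2) ^+ i * (HN k)%:~R.

(* The v_i are the coefficients of the expansion of HN at t = e^x. *)
Lemma vcoef_expansion (R : realType) (HN : laurent1) (x : R) :
  series (fun i : nat => vcoef R HN i * x ^+ i) @ \oo
    --> eval1 HN (expR (x / 2)).
Proof.
have expRz (y : R) (k : int) : expR (k%:~R * y) = expR y ^ k.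
  case: k => n; first by rewrite -exprnP -expRM_natl.
  by rewrite NegzE mulrNz mulNr expRN -exprnN -expRM_natl.
have -> : series (fun i : nat => vcoef R HN i * x ^+ i) =
    (fun m => \sum_(k <- finsupp HN)
      ((HN k)%:~R * series (exp_coeff (k%:~R * (x / 2))) m)).
  apply/funext => m; rewrite /series /=.
  under [RHS]eq_bigr do rewrite mulr_sumr.
  rewrite [RHS]exchange_big /=; apply: eq_bigr => i _.
  rewrite /vcoef mulr_sumr mulr_suml; apply: eq_bigr => k _.
  rewrite /exp_coeff /= !exprMn; ring.
rewrite /eval1; apply: cvg_big => [|k _]; first exact: add_continuous.
rewrite -expRz; apply: cvgMl_tmp.
exact: is_cvg_series_exp_coeff.
Qed.

(* -d, ..., d *)
Definition zrange (d : nat) : seq int :=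
  [seq k%:Z - d%:Z | k <- iota 0 (2 * d).+1].

Definition f_fin (R : realType) (d : nat) (n : int) (v : R) : R :=
  \prod_(j <- zrange d | j != n) ((2 * v - j%:~R) / (n%:~R - j%:~R)).

Definition f_inf (R : realType) (n : int) (v : R) : R :=
  if 2 * v == n%:~R then 1
  else sin (pi * (2 * v - n%:~R)) / (pi * (2 * v - n%:~R)).

(* Main.v *)
(** For a function [f] whose Taylor series at 0 converges to it,
    [\sum_i f^(i)(0) * v_i = \sum_k b_k f(k/2)], since [v_i] is [1/i!] times the
    [i]-th moment of the coefficients [b_k] placed at the points [k/2].  Both
    [f_{d,n}] and [f_{oo,n}] interpolate the Kronecker delta: they take
    the value 1 at [n/2] and 0 at the other half-integers [k/2] (with [|k| <= d]
    in the first case).  The first function is a polynomial of degree [2d].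
    The second is an entire function whose [m]-th derivative at [n/2] is bounded by
    [(2 pi)^m], and this bound makes its Taylor remainder at 0 vanish. *)

Require Import Defs.
From mathcomp Require Import all_boot all_order all_algebra finmap.
From mathcomp Require Import zify ring lra.
From mathcomp Require Import all_classical all_reals all_analysis.
Set Implicit Arguments.
Unset Strict Implicit.
Unset Printing Implicit Defensive.

Import Order.TTheory GRing.Theory Num.Theory.
Import numFieldNormedType.Exports.
Local Open Scope ring_scope.
Local Open Scope classical_set_scope.

(** * Taylor series under a geometric bound on the derivatives *)

(** The remainder of order [m] is at most a constant times [(|K| |z|)^m / m!], a term of a
    convergent exponential series, so it tends to 0. *)
Lemma cvg_taylor (R : realType) (g : nat -> R -> R) (M K z : R) :
  (forall i (x : R), is_derive x 1 (g i) (g i.+1 x)) ->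
  (forall i s, 0 <= s <= 1 -> `|g i (s * z)| <= M * K ^+ i) ->
  series (fun i => g i 0 / i`!%:R * z ^+ i) @ \oo --> g 0 z.
Proof.
move=> dg gM.
(* The mean value theorem is applied to [T m] along the segment from 0 to [z];
   its derivative telescopes. *)
pose T m (x : R) := \sum_(i < m.+1) g i x / i`!%:R * (z - x) ^+ i.
have dT m (x : R) : is_derive x 1 (T m) (g m.+1 x / m`!%:R * (z - x) ^+ m).
  elim: m => [|m IH].
    rewrite (_ : T 0 = g 0); last first.
      by apply/funext => y; rewrite /T big_ord1 fact0 divr1 expr0 mulr1.
    by rewrite fact0 divr1 expr0 mulr1; exact: dg.
  rewrite (_ : T m.+1 = fun y =>
      T m y + g m.+1 y * (m.+1`!%:R^-1 * (z - y) ^+ m.+1)); last first.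
    by apply/funext => y; rewrite /T big_ord_recr /= mulrA.
  have dzx : is_derive x 1 (fun y : R => m.+1`!%:R^-1 * (z - y) ^+ m.+1)
      (- (m`!%:R^-1 * (z - x) ^+ m)).
    rewrite (_ : m`!%:R^-1 = m.+1%:R / m.+1`!%:R); last first.
      by rewrite factS natrM invfM mulVKf ?pnatr_eq0.
    move: (_`!%:R^-1) => q.
    have dz : is_derive x 1 (fun y => z - y) (-1).
      by apply: is_derive_eq; rewrite add0r mul1r.
    have dX := is_deriveX m.+1 dz.
    have -> : (fun y => q * (z - y) ^+ m.+1) =
        cst q * (fun y => z - y) ^+ m.+1 by rewrite exprfctE.
    apply: (is_derive_eq (is_deriveM (is_derive_cst q x 1) dX)).
    by rewrite /GRing.scale /=; ring.
  have dgx := dg m.+1 x.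
  by apply: is_derive_eq; rewrite /GRing.scale /=; ring.
have dTz m (s : R) : is_derive s 1 (fun s => T m (s * z))
    (g m.+1 (s * z) / m`!%:R * (z - s * z) ^+ m * z).
  have dsz : is_derive s 1 (fun s : R => s * z) z.
    by apply: is_derive_eq; rewrite scaler0 add0r /GRing.scale /= mulr1.
  exact: (is_derive1_comp (f := T m) (g := fun s : R => s * z)
    (dT m (s * z)) dsz).
have Tz m : T m z = g 0 z.
  rewrite /T big_ord_recl /= fact0 divr1 expr0 mulr1 big1 ?addr0 // => i _.
  by rewrite subrr expr0n mulr0.
have M0 : 0 <= M.
  have := gM 0 0; rewrite expr0 mulr1 lexx ler01 => /(_ isT).
  exact: le_trans.
have bound m : `|T m 0 - g 0 z| <= M * `|K| * `|z| * exp_coeff (`|K| * `|z|) m.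
  have [|s] := MVT (f := fun s => T m (s * z)) ltr01 (fun s _ => dTz m s).
    apply/continuous_subspaceT => s.
    by apply/differentiable_continuous/derivable1_diffP; case: (dTz m s).
  rewrite in_itv /= => /andP[s0 s1]; rewrite mul1r mul0r subr0 mulr1 Tz => E.
  rewrite distrC E !normrM normfV normr_nat normrX.
  have -> : M * `|K| * `|z| * exp_coeff (`|K| * `|z|) m =
      M * `|K| ^+ m.+1 / m`!%:R * `|z| ^+ m * `|z|.
    by rewrite /exp_coeff /= exprMn exprS; ring.
  rewrite ler_wpM2r // ler_pM ?mulr_ge0 ?invr_ge0 //.
    rewrite ler_wpM2r ?invr_ge0 //; apply: le_trans (gM _ _ _) _.
      by rewrite !ltW.
    by rewrite ler_wpM2l // -normrX ler_norm.
  (* Here [z - s * z = (1 - s) * z] with [0 < s < 1]. *)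
  rewrite lerXn2r ?nnegrE // -{1}(mul1r z) -mulrBl normrM ler_piMl //.
  by rewrite ger0_norm; lra.
(* [T m] has [m.+1] terms, so it is the partial sum of index [m.+1]. *)
rewrite -cvg_shiftS.
apply: (@cvg_sub0 _ _ _ _ _ _ (fun=> g 0 z)); last exact: cvg_cst.
apply: norm_cvg0.
have := cvgMl_tmp (a := M * `|K| * `|z|) (cvg_exp_coeff (`|K| * `|z|)).
rewrite mulr0 => M_cvg0.
apply: (squeeze_cvgr _ (cvg_cst 0) (M_cvg0 _)).
apply: nearW => m; rewrite normr_ge0 /=.
rewrite (le_trans _ (bound m)) // !fctE /= /series /= big_mkord /T.
by under [in leRHS]eq_bigr do rewrite subr0.
Qed.

(** * Exponential generating functions *)

(** Dividing by [m!] makes differentiation a shift of [c]. The limit is meaningful where the series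
    converges, which a geometric bound on [c] ensures everywhere. *)
Definition egf (R : realType) (c : nat -> R) (x : R) : R :=
  limn (pseries (fun m => c m / m`!%:R) x).

Section ExponentialGeneratingFunction.
Variables (R : realType) (c : nat -> R) (C K : R).
Hypothesis (c_le : forall m, `|c m| <= C * K ^+ m).

Let term_le (x : R) m :
  `|c m / m`!%:R * x ^+ m| <= C * exp_coeff (K * `|x|) m.
Proof.
rewrite !normrM normfV normr_nat normrX /exp_coeff /= exprMn.
rewrite [leRHS](_ : _ = C * K ^+ m / m`!%:R * `|x| ^+ m).
  by rewrite !ler_wpM2r ?invr_ge0.
ring.
Qed.

Let is_cvg_dominating (x : R) : cvgn (series (C *: exp_coeff (K * `|x|))).
Proof. by apply: is_cvg_seriesZ; exact: is_cvg_series_exp_coeff. Qed.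

Let is_cvg_egf_norm (x : R) :
  cvgn [normed pseries (fun m => c m / m`!%:R) x].
Proof.
apply: series_le_cvg (term_le x) (@is_cvg_dominating x) => // m.
exact: le_trans (term_le x m).
Qed.

Lemma is_cvg_egf (x : R) : cvgn (pseries (fun m => c m / m`!%:R) x).
Proof. exact: normed_cvg. Qed.

Lemma egf_le (x : R) : `|egf c x| <= C * expR (K * `|x|).
Proof.
apply: le_trans (lim_series_norm (@is_cvg_egf_norm x)) _.
apply: le_trans (lim_series_le (@is_cvg_egf_norm x) (@is_cvg_dominating x)
  (term_le x)) _.
by rewrite lim_seriesZ //; exact: is_cvg_series_exp_coeff.
Qed.

End ExponentialGeneratingFunction.

Lemma pseries_diffs_egf (R : realType) (c : nat -> R) :
  pseries_diffs (fun m => c m / m`!%:R) = (fun m => c m.+1 / m`!%:R).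
Proof.
apply/funext => m; rewrite /pseries_diffs factS natrM invfM.
by rewrite mulrCA mulVKf ?pnatr_eq0.
Qed.

Lemma is_derive_egf (R : realType) (c : nat -> R) (C K x : R) :
  (forall m, `|c m| <= C * K ^+ m) ->
  is_derive x 1 (egf c) (egf (c \o succn) x).
Proof.
move=> cK.
have shift_le (c' : nat -> R) C' : (forall m, `|c' m| <= C' * K ^+ m) ->
    forall m, `|(c' \o succn) m| <= C' * K * K ^+ m.
  by move=> c'K m; rewrite -mulrA -exprS; exact: c'K.
rewrite /egf -(pseries_diffs_egf c).
(* Termwise differentiation at [x] asks that the series and its first two formal derivatives
   converge at a point of modulus larger than [|x|]. *)
apply: (@pseries_snd_diffs _ _ (`|x| + 1)).
- exact: is_cvg_egf cK _.
- rewrite pseries_diffs_egf; exact: is_cvg_egf (shift_le _ _ cK) _.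
- rewrite !pseries_diffs_egf.
  exact: is_cvg_egf (shift_le _ _ (shift_le _ _ cK)) _.
- by rewrite [ltRHS]ger0_norm ?ltrDl // addr_ge0.
Qed.

Lemma derive1n_seq (R : realType) (g : nat -> R -> R) :
  (forall i (x : R), is_derive x 1 (g i) (g i.+1 x)) ->
  forall i, derive1n i (g 0) = g i.
Proof.
move=> dg; elim=> [//|i IH]; rewrite derive1nS IH.
by apply/funext => x; rewrite derive1E; case: (dg i x).
Qed.

(** This moves the centre of expansion from [a] to 0: the [i]-th derivative of [f] is generated by
    [c] shifted by [i], so it is at most [K^i] times an exponential that does not depend on [i]. *)
Lemma cvg_taylor_egf (R : realType) (c : nat -> R) (K a z : R) :
  0 <= K -> (forall m, `|c m| <= K ^+ m) ->
  let f v := egf c (v - a) in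
  series (fun i => derive1n i f 0 / i`!%:R * z ^+ i) @ \oo --> f z.
Proof.
move=> K0 cK f.
pose g i (v : R) := egf (fun m => c (m + i)%N) (v - a).
have ciK i m : `|c (m + i)%N| <= K ^+ i * K ^+ m by rewrite -exprD addnC.
have dg i (x : R) : is_derive x 1 (g i) (g i.+1 x).
  have dxa : is_derive x 1 (fun v => v - a) 1.
    by apply: is_derive_eq; rewrite subr0.
  have := is_derive1_comp (g := fun v : R => v - a)
    (is_derive_egf (x - a) (ciK i)) dxa.
  rewrite mulr1; congr (is_derive _ _ _ (egf _ _)).
  by apply/funext => m /=; rewrite addSnnS.
have g0 : g 0 = f.
  by rewrite /g; apply/funext => v; congr egf; apply/funext => m; rewrite addn0.
rewrite -g0.
under [X in series X]eq_fun do rewrite (derive1n_seq dg).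
(* The constant comes from [|s * z - a| <= |z| + |a|] on the segment. *)
apply: (@cvg_taylor _ g (expR (K * (`|z| + `|a|))) K) => // i s /andP[s0 s1].
apply: le_trans (egf_le (ciK i) _) _.
rewrite mulrC ler_wpM2r ?exprn_ge0 // ler_expR ler_wpM2l //.
apply: le_trans (ler_normB _ _) _.
by rewrite lerD2r normrM ler_piMl // ger0_norm.
Qed.

(** * The function [sin y / y] and [f_inf] *)

(** The [m]-th derivative at 0 of [sin y / y], extended by 1 at 0. *)
Definition sinc_coeff (R : realType) (m : nat) : R :=
  (~~ odd m)%:R * (-1) ^+ m./2 / m.+1%:R.

Lemma sinc_coeff_le1 (R : realType) m : `|sinc_coeff R m| <= 1.
Proof.
rewrite !normrM normfV !normr_nat normrX normrN1 expr1n mulr1.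
rewrite ler_pdivrMr // mul1r; apply: (@le_trans _ _ 1); first by case: odd.
by rewrite ler1n.
Qed.

Lemma mul_egf_sinc (R : realType) (y : R) : y * egf (@sinc_coeff R) y = sin y.
Proof.
have sinc_cvg : pseries (fun m => sinc_coeff R m / m`!%:R) y @ \oo
    --> egf (@sinc_coeff R) y.
  apply: (@is_cvg_egf _ _ 1 1) => m.
  by rewrite expr1n mul1r; exact: sinc_coeff_le1.
rewrite unlock; apply/esym/cvg_lim => //.
(* The sine series has no constant term; dropping it leaves [y] times the series of [sinc_coeff]. *)
rewrite -cvg_shiftS.
rewrite (_ : [sequence _]_n = fun n =>
  y * pseries (fun m => sinc_coeff R m / m`!%:R) y n); last first.
  apply/funext => n; rewrite /pseries /series /= big_nat_recl //.
  rewrite [X in X + _]/sin_coeff /= !mul0r add0r mulr_sumr.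
  apply: eq_bigr => i _; rewrite /sin_coeff /sinc_coeff /= exprS factS natrM.
  by rewrite invfM; ring.
exact: cvgMl_tmp.
Qed.

Lemma egf0 (R : realType) (c : nat -> R) : egf c 0 = c 0.
Proof.
apply/cvg_lim => //; rewrite -cvg_shiftS.
rewrite (_ : [sequence _]_n = fun=> c 0); first exact: cvg_cst.
apply/funext => n; rewrite /pseries /series /= big_nat_recl //.
rewrite fact0 divr1 expr0 mulr1 big1 ?addr0 // => i _.
by rewrite expr0n mulr0.
Qed.

Lemma egf_scale (R : realType) (c : nat -> R) (K x : R) :
  egf (fun m => c m * K ^+ m) x = egf c (K * x).
Proof.
rewrite /egf /pseries; congr (limn (series _)); apply/funext => m.
by rewrite /= exprMn; ring.
Qed.

(** A single power series centred at [n/2] covers both cases of [f_inf], the value 1 being its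
    constant term. *)
Lemma f_inf_egf (R : realType) (n : int) :
  @f_inf R n =
  fun v => egf (fun m => sinc_coeff R m * (2 * pi) ^+ m) (v - n%:~R / 2).
Proof.
apply/funext => v; rewrite egf_scale.
have -> : 2 * pi * (v - n%:~R / 2) = pi * (2 * v - n%:~R) :> R by field.
rewrite /f_inf; case: eqP => [->|/eqP vn].
  by rewrite subrr mulr0 egf0 /sinc_coeff /= expr0 mulr1 divr1.
rewrite -mul_egf_sinc [pi * _ * _]mulrC mulfK //.
by rewrite mulf_neq0 ?subr_eq0 // gt_eqF // pi_gt0.
Qed.

Lemma sin_intpi (R : realType) (k : int) : sin (pi * k%:~R) = 0 :> R.
Proof.
have sin_natpi (m : nat) : sin (pi * m%:R) = 0 :> R.
  elim: m => [|m IH]; first by rewrite mulr0 sin0.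
  by rewrite -addn1 natrD mulrDr mulr1 sinDpi IH oppr0.
case: k => m; first exact: sin_natpi.
by rewrite NegzE mulrNz mulrN sinN sin_natpi oppr0.
Qed.

Lemma f_inf_half (R : realType) (n k : int) :
  @f_inf R n (k%:~R / 2) = (k == n)%:R.
Proof.
rewrite /f_inf mulrC divfK // eqr_int; case: eqP => // _.
by rewrite -intrB sin_intpi mul0r.
Qed.

Lemma cvg_taylor_f_inf (R : realType) (n : int) (z : R) :
  series (fun i => derive1n i (@f_inf R n) 0 / i`!%:R * z ^+ i) @ \oo
    --> @f_inf R n z.
Proof.
rewrite f_inf_egf; apply: (@cvg_taylor_egf _ _ (2 * pi)).
  by rewrite mulr_ge0 // pi_ge0.
move=> m; rewrite normrM normrX (ger0_norm (_ : 0 <= 2 * pi)); last first.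
  by rewrite mulr_ge0 // pi_ge0.
by rewrite ler_piMl ?sinc_coeff_le1 // exprn_ge0 // mulr_ge0 // pi_ge0.
Qed.

(** * The interpolation polynomial [f_fin] *)

Lemma mem_zrange d (k : int) : (k \in zrange d) = (`|k| <= d%:Z).
Proof.
apply/mapP/idP => [[i]|kd].
  by rewrite mem_iota => ? ->; lia.
by exists (absz (k + d%:Z)); [rewrite mem_iota|]; lia.
Qed.

Lemma zrange_uniq d : uniq (zrange d).
Proof. by rewrite map_inj_uniq ?iota_uniq // => i j; lia. Qed.

Lemma derive1n_horner (R : realType) (p : {poly R}) i :
  derive1n i (horner p) = horner p^`(i).
Proof.
by elim: i => [//|i IH]; rewrite derive1nS IH derivnS derivE.
Qed.

Lemma f_fin_poly (R : realType) d (n : int) : n \in zrange d ->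
  exists2 p : {poly R}, @f_fin R d n = horner p & (size p <= (2 * d).+1)%N.
Proof.
move=> nd; pose r := [seq j <- zrange d | j != n].
exists ((\prod_(j <- r) (2 / (n%:~R - j%:~R))) *:
        \prod_(j <- r) ('X - (j%:~R / 2)%:P)).
  apply/funext => v; rewrite /f_fin -big_filter -/r hornerZ horner_prod.
  rewrite -big_split /=; apply: eq_bigr => j _; rewrite hornerXsubC.
  by rewrite mulrAC mulrBr [2 * (_ / _)]mulrC divfK.
apply: leq_trans (size_scale_leq _ _) _; rewrite size_prod_XsubC ltnS.
(* Removing [n] from the [2d + 1] distinct points leaves [2d] roots. *)
rewrite /r -rem_filter ?zrange_uniq // size_rem // size_map size_iota.
by rewrite leqnn.
Qed.

Lemma f_fin_half (R : realType) d (n k : int) : k \in zrange d ->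
  @f_fin R d n (k%:~R / 2) = (k == n)%:R.
Proof.
move=> kd; rewrite /f_fin mulrC divfK //; case: eqP => [->|/eqP kn].
  by apply: big1 => j jn; rewrite divff // subr_eq0 eqr_int eq_sym.
apply/eqP; rewrite prodf_seq_eq0; apply/hasP; exists k => //.
by rewrite kn subrr mul0r eqxx.
Qed.

Lemma taylor_f_fin (R : realType) d (n : int) (z : R) : n \in zrange d ->
  \sum_(0 <= i < (2 * d).+1) derive1n i (@f_fin R d n) 0 / i`!%:R * z ^+ i =
  @f_fin R d n z.
Proof.
move=> /(@f_fin_poly R)[p -> sp]; rewrite -[z in RHS]add0r.
(* The polynomial is expanded at 0, with increment [z]. *)
rewrite (nderiv_taylor_wide (mulrC _ _) sp) big_mkord; apply: eq_bigr => i _.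
by rewrite derive1n_horner nderivn_def hornerMn -mulr_natr mulfK.
Qed.

(** * From moments back to coefficients *)

(** Exchanging two finite sums turns the [1/i!] of [vcoef] into that of a Taylor polynomial at 0,
    evaluated at [k/2]. *)
Lemma sum_vcoef (R : realType) (a : nat -> R) (b : laurent1) m :
  \sum_(0 <= i < m) a i * vcoef R b i =
  \sum_(k <- finsupp b)
    (b k)%:~R * \sum_(0 <= i < m) a i / i`!%:R * (k%:~R / 2) ^+ i.
Proof.
under [RHS]eq_bigr do rewrite mulr_sumr.
rewrite [RHS]exchange_big /=; apply: eq_bigr => i _.
by rewrite /vcoef !mulr_sumr; apply: eq_bigr => k _; ring.
Qed.

Lemma sum_delta (R : realType) (b : laurent1) (n : int) :
  \sum_(k <- finsupp b) (b k)%:~R * (k == n)%:R = (b n)%:~R :> R.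
Proof.
have [nb|] := boolP (n \in finsupp b).
  rewrite (big_fsetD1 n) //= eqxx mulr1 big_seq big1 ?addr0 // => k.
  by rewrite in_fsetD1 => /andP[/negPf -> _]; rewrite mulr0.
rewrite memNfinsupp => /eqP bn; rewrite bn big1_seq // => k _.
by case: eqP => [->|_]; rewrite ?bn ?mul0r ?mulr0.
Qed.

Theorem theorem5p4 (R : realType) (H : link R -> laurent2)
    (homflyH : is_homfly H) (L : link R) (N : int) (N_neq0 : N != 0)
    (b : laurent1) (bE : Nth_specialization N (H L) b)
    (d : nat) (b_bound : forall n : int, d%:Z < `|n| -> b n = 0) :
  (forall n : int, - d%:Z <= n <= d%:Z ->
     (b n)%:~R
     = \sum_(0 <= i < (2 * d).+1) derive1n i (@f_fin R d n) 0 * vcoef R b i)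
  /\
  (forall n : int,
     series (fun i : nat => derive1n i (@f_inf R n) 0 * vcoef R b i) @ \oo
       --> ((b n)%:~R : R)).
Proof.
split=> n; last first.
  rewrite -sum_delta.
  rewrite (_ : series _ = fun m => \sum_(k <- finsupp b) (b k)%:~R *
      series (fun i => derive1n i (@f_inf R n) 0 / i`!%:R
                       * (k%:~R / 2) ^+ i) m); last first.
    by apply/funext => m; rewrite /series /= sum_vcoef.
  apply: cvg_big => [|k _]; first exact: add_continuous.
  (* The Kronecker delta is replaced by the value of [f_inf] at [k/2], the sum of its Taylor
     series. *)
  apply: cvgMl_tmp; rewrite -f_inf_half; exact: cvg_taylor_f_inf.
rewrite -ler_norml -mem_zrange => nd; rewrite sum_vcoef -[LHS]sum_delta.
(* Membership in the support is kept because, with [b_bound], it places [k] among the interpolation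
   points. *)
rewrite !big_seq; apply: eq_bigr => k; rewrite mem_finsupp => bk.
rewrite taylor_f_fin // f_fin_half // mem_zrange leNgt.
by apply: contra bk => /b_bound ->.
Qed.
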